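(* Let $S$ be a set with $2 \leq |S| < \infty$, let $(X_s)_{s \in S}$ be a family of nonempty finitely generated racks, and let $X = \ast_{s \in S} X_s$ be their free product. Then the map $\hat{\phi} \colon V_0(\mathrm{Ad}(X)) \to H_{\mathrm{b}}^2(X, \mathbb{R})$ defined by $$\hat{\phi}(\lambda) = [\delta^1 \hat{\phi}_\lambda]_{\mathrm{b}}$$ is an injective linear map.
   Context: A rack is a set $X$ with a binary operation $\triangleleft \colon X \times X \to X$ such that $(x \triangleleft y) \triangleleft z = (x \triangleleft z) \triangleleft (y \triangleleft z)$ for all $x,y,z \in X$, and for every $y \in X$ the map $\psi_y \colon X \to X$, $\psi_y(x) = x \triangleleft y$, is bijective. Write $x \triangleleft^n y = \psi_y^n(x)$ for $n \in \mathbb{Z}$. A rack $X$ is finitely generated if there is a finite subset $A \subset X$ such that every $x \in X$ can be written as $x = (\cdots((a_0 \triangleleft^{\varepsilon_1} a_1) \triangleleft^{\varepsilon_2} a_2) \cdots) \triangleleft^{\varepsilon_n} a_n$ with $n \geq 0$, $a_0, \dots, a_n \in A$ and $\varepsilon_i \in \{\pm 1\}$. The adjoint group of a rack $X$ is $\mathrm{Ad}(X) = \langle e_x \ (x \in X) \mid e_x e_y = e_y e_{x \triangleleft y} \ (x, y \in X) \rangle$. It acts on $X$ from the right by $x \cdot e_y = x \triangleleft y$. Free product of racks: given racks $X_s$ ($s \in S$), the free product $\ast_{s \in S} X_s$ is the set of pairs $(x, g)$ with $x \in X_t$ for some $t \in S$ and $g \in \ast_{s \in S} \mathrm{Ad}(X_s)$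 (free product of groups), modulo the equivalence relation generated by $(x, g w) \sim (x \cdot g, w)$ for $t \in S$, $x \in X_t$, $g \in \mathrm{Ad}(X_t)$, $w \in \ast_{s \in S} \mathrm{Ad}(X_s)$. The operation is $(x, g) \triangleleft (y, h) = (x, g h^{-1} e_y h)$, which is well defined. The adjoint group $\mathrm{Ad}(\ast_{s \in S} X_s)$ is identified with $\ast_{s \in S} \mathrm{Ad}(X_s)$. Factorization: every $g \neq 1$ in a free product of groups $\ast_{s \in S} \Gamma_s$ is uniquely a product $g = g_1 \cdots g_n$ with $1 \neq g_i \in \Gamma_{s_i}$ and $s_i \neq s_{i+1}$; this is the factorization of $g$ (for $g = 1$ it is empty, $n = 0$). Reduced: a pair $(x, g)$ with $x \in X_t$ and $g$ with factorization $g_1 \cdots g_n$, $g_1 \in \mathrm{Ad}(X_{s_1})$, is reduced if $s_1 \neq t$ (or $g = 1$). Every element of $\ast_{s \in S} X_s$ is represented by a reduced pair. For a free product $\Gamma = \ast_{s \in S} \Gamma_s$ of nontrivial groups, $V_0(\Gamma)$ is the real vector space of families $\lambda = (\lambda_s)_{s \in S}$ where each $\lambda_s \colon \Gamma_s \to \mathbb{R}$ is bounded and odd ($\lambda_s(g^{-1}) = -\lambda_s(g)$) and $\sup_{s \in S} \|\lambda_s\|_\infty < \infty$. Here $V_0(\mathrm{Ad}(X))$ is taken with respect to the decomposition $\mathrm{Ad}(X) = \ast_{s \in S} \mathrm{Ad}(X_s)$. For $\lambda \in V_0(\mathrm{Ad}(X))$, define $\phi_\lambda(g) = \sum_{i=1}^n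 \lambda_{s_i}(g_i)$ for $g \in \ast_{s\in S} \mathrm{Ad}(X_s)$ with factorization $g = g_1 \cdots g_n$, $g_i \in \mathrm{Ad}(X_{s_i})$, and define $\hat{\phi}_\lambda \colon X \to \mathbb{R}$ by $\hat{\phi}_\lambda(x, g) = \phi_\lambda(g)$ for $(x,g)$ reduced. Bounded rack cohomology: for $n \geq 0$ let $C^n(X; \mathbb{R})$ be the space of functions $X^n \to \mathbb{R}$ ($X^0$ a one-point set) and $C^n_{\mathrm{b}}(X; \mathbb{R})$ the subspace of bounded functions. For $n \ge 1$ let $$\delta^n f(x_1, \dots, x_{n+1}) = \sum_{i=1}^{n+1} (-1)^i \left[ f(x_1, \dots, x_{i-1}, x_{i+1}, \dots, x_{n+1}) - f(x_1 \triangleleft x_i, \dots, x_{i-1} \triangleleft x_i, x_{i+1}, \dots, x_{n+1}) \right],$$ and $\delta^n = 0$ for $n \leq 0$; $\delta^n$ preserves boundedness. $H^n_{\mathrm{b}}(X, \mathbb{R})$ is the $n$-th cohomology of $(C^\ast_{\mathrm{b}}(X; \mathbb{R}), \delta^\ast)$, and $[c]_{\mathrm{b}}$ denotes the class of a bounded cocycle $c$ in it. In particular $\delta^1 f(x,y) = f(x) - f(x \triangleleft y)$. *)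

(* Defs.v *)
From HB Require Import structures.
From Stdlib Require Import Relation_Operators.
From mathcomp Require Import all_boot all_order all_algebra.
From mathcomp Require Import boolp classical_sets functions reals.

Set Implicit Arguments.
Unset Strict Implicit.
Unset Printing Implicit Defensive.

Import Order.TTheory GRing.Theory Num.Theory.

Local Open Scope classical_set_scope.
Local Open Scope quotient_scope.

HB.mixin Record isRack X of Choice X := {
  rack_op : X -> X -> X;
  rack_distr : forall x y z,
    rack_op (rack_op x y) z = rack_op (rack_op x z) (rack_op y z);
  rack_bij : forall y, bijective (rack_op^~ y)
}.

#[short(type="rackType")]
HB.structure Definition Rack := {X of isRack X & Choice X}.

Notation "x ◁ y" := (rack_op x y) (at level 40, left associativity) : rack_scope.
Local Open Scope rack_scope.

Section RackTheory.
Variable X : rackType.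
Implicit Types (x y z : X) (w : seq (X * bool)).

(* [rack_opV x y] is psi_y^-1 (x); the default [x] is never used. *)
Definition rack_opV x y : X := xget x [set z | z ◁ y = x].

Lemma rack_opVK y : cancel (rack_opV^~ y) (rack_op^~ y).
Proof.
move=> x; rewrite /rack_opV /=.
have [g _ gK] := rack_bij y.
have : (exists z, [set z | z ◁ y = x] z) by exists (g x); exact: gK.
by move/(xgetPex x).
Qed.

Lemma rack_opK y : cancel (rack_op^~ y) (rack_opV^~ y).
Proof. by move=> x; apply: (bij_inj (rack_bij y)); exact: rack_opVK. Qed.

(* A letter [(y, true)] stands for [y], a letter [(y, false)] for its inverse. *)
Definition rack_exp x (l : X * bool) : X :=
  if l.2 then x ◁ l.1 else rack_opV x l.1.

Definition rack_word x w : X := foldl rack_exp x w.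

Definition rack_fg : Prop :=
  exists A : seq X, forall x, exists a0 w,
    [/\ a0 \in A, all (fun l => l.1 \in A) w & x = rack_word a0 w].

End RackTheory.

Section Presentation.
Variables (T : choiceType) (rel : seq (T * bool) -> seq (T * bool) -> Prop).
Notation word := (seq (T * bool)).

Inductive pcong : word -> word -> Prop :=
| pcong_refl u : pcong u u
| pcong_sym u v : pcong u v -> pcong v u
| pcong_trans u v w : pcong u v -> pcong v w -> pcong u w
| pcong_cat u u' v v' : pcong u u' -> pcong v v' -> pcong (u ++ v) (u' ++ v')
| pcong_cancel x b : pcong [:: (x, b); (x, ~~ b)] [::]
| pcong_rel u v : rel u v -> pcong u v.

Definition pcongb (u v : word) : bool := `[< pcong u v >].

Lemma pcongb_refl : reflexive pcongb.
Proof. by move=> u; apply/asboolP; exact: pcong_refl. Qed.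

Lemma pcongb_sym : symmetric pcongb.
Proof.
by move=> u v; apply/asboolP/asboolP; exact: pcong_sym.
Qed.

Lemma pcongb_trans : transitive pcongb.
Proof.
move=> v u w /asboolP uv /asboolP vw; apply/asboolP.
exact: pcong_trans uv vw.
Qed.

Canonical pcong_equiv := EquivRel pcongb pcongb_refl pcongb_sym pcongb_trans.

Definition pgroup : Type := {eq_quot pcong_equiv}.
HB.instance Definition _ := Choice.on pgroup.
HB.instance Definition _ := EqQuotient.on pgroup.

Lemma pgroupP (u v : word) : pcong u v <-> \pi_pgroup u = \pi_pgroup v.
Proof.
split=> [uv|/eqmodP uv]; last exact/asboolP.
by apply/eqmodP/asboolP.
Qed.

Lemma pcong_repr (u : word) : pcong (repr (\pi_pgroup u)) u.
Proof. by apply/pgroupP; rewrite reprK. Qed.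

Definition word_inv (u : word) : word := rev [seq (l.1, ~~ l.2) | l <- u].

Lemma pcong_mulV u : pcong (u ++ word_inv u) [::].
Proof.
elim: u => [|[x b] u IH]; first exact: pcong_refl.
rewrite /word_inv /= rev_cons -cats1 catA.
apply: pcong_trans (pcong_cancel x b).
rewrite -[(x, b) :: _]/([:: (x, b)] ++ _) -[X in pcong _ X]/([:: (x, b)] ++ [:: _]).
apply: pcong_cat; first exact: pcong_refl.
rewrite -[X in pcong _ X]cat0s; apply: pcong_cat => //; exact: pcong_refl.
Qed.

Lemma word_invK : involutive word_inv.
Proof.
move=> u; rewrite /word_inv map_rev revK -map_comp map_id_in // => -[x b] _ /=.
by rewrite negbK.
Qed.

Lemma pcong_inv u v : pcong u v -> pcong (word_inv u) (word_inv v).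
Proof.
move=> uv.
have h1 : pcong (word_inv u) (word_inv u ++ (v ++ word_inv v)).
  rewrite -[X in pcong X _]cats0; apply: pcong_cat; first exact: pcong_refl.
  exact/pcong_sym/pcong_mulV.
apply: pcong_trans h1 _; rewrite catA -[X in pcong _ X]cat0s.
apply: pcong_cat; last exact: pcong_refl.
apply: pcong_trans (_ : pcong _ (word_inv u ++ u)) _.
  by apply: pcong_cat; [exact: pcong_refl|exact: pcong_sym].
by rewrite -{2}(word_invK u); exact: pcong_mulV.
Qed.

Definition pg_one : pgroup := \pi_pgroup [::].
Definition pg_mul : pgroup -> pgroup -> pgroup := lift_op2 pgroup (@cat (T * bool)).
Definition pg_inv : pgroup -> pgroup := lift_op1 pgroup word_inv.

Lemma pg_mul_pi u v : pg_mul (\pi_pgroup u) (\pi_pgroup v) = \pi_pgroup (u ++ v).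
Proof. by unlock pg_mul; apply/pgroupP/pcong_cat; exact: pcong_repr. Qed.

Lemma pg_inv_pi u : pg_inv (\pi_pgroup u) = \pi_pgroup (word_inv u).
Proof. by unlock pg_inv; apply/pgroupP/pcong_inv; exact: pcong_repr. Qed.

Lemma pg_mulA : associative pg_mul.
Proof.
move=> a b c; rewrite -[a]reprK -[b]reprK -[c]reprK.
by rewrite !pg_mul_pi catA.
Qed.

Lemma pg_mul1 : left_id pg_one pg_mul.
Proof. by move=> a; rewrite -[a]reprK pg_mul_pi. Qed.

Lemma pg_mulr1 : right_id pg_one pg_mul.
Proof. by move=> a; rewrite -[a]reprK pg_mul_pi cats0. Qed.

Lemma pg_mulVr : right_inverse pg_one pg_inv pg_mul.
Proof.
move=> a; rewrite -[a]reprK pg_inv_pi pg_mul_pi.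
exact/pgroupP/pcong_mulV.
Qed.

Lemma pg_mulV : left_inverse pg_one pg_inv pg_mul.
Proof.
move=> a; rewrite -[a]reprK pg_inv_pi pg_mul_pi.
by apply/pgroupP; rewrite -{2}(word_invK (repr a)); exact: pcong_mulV.
Qed.

HB.instance Definition _ :=
  isGroup.Build pgroup pg_mulA pg_mul1 pg_mulr1 pg_mulV pg_mulVr.

Definition pgen (x : T) : pgroup := \pi_pgroup [:: (x, true)].

Lemma pgroup_mulE (u v : word) :
  (\pi_pgroup u * \pi_pgroup v)%g = \pi_pgroup (u ++ v).
Proof. exact: pg_mul_pi. Qed.

Lemma pgroup_invE (u : word) : ((\pi_pgroup u)^-1)%g = \pi_pgroup (word_inv u).
Proof. exact: pg_inv_pi. Qed.

End Presentation.

Section Adjoint.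
Variable X : rackType.
Implicit Types (x y z : X) (w : seq (X * bool)).

Inductive ad_rel : seq (X * bool) -> seq (X * bool) -> Prop :=
| AdRel x y :
    ad_rel [:: (x, true); (y, true)] [:: (y, true); (x ◁ y, true)].

Definition Ad : Type := pgroup ad_rel.
HB.instance Definition _ := Group.on Ad.
HB.instance Definition _ := EqQuotient.on Ad.

Definition ad_gen x : Ad := pgen ad_rel x.

Lemma rack_word_pcong x u v : pcong ad_rel u v -> rack_word x u = rack_word x v.
Proof.
move=> uv; elim: uv x => {u v}.
- by [].
- by move=> u v _ IH x.
- by move=> u v w _ uv _ vw x; rewrite uv.
- by move=> u u' v v' _ uu' _ vv' x; rewrite /rack_word !foldl_cat -!/(rack_word _ _) uu' vv'.
- by move=> y [] x; rewrite /rack_word /= /rack_exp /= ?rack_opK ?rack_opVK.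
- by move=> _ _ [y z] x; rewrite /rack_word /= /rack_exp /= rack_distr.
Qed.

Definition ad_act x (g : Ad) : X := rack_word x (repr g).

Lemma ad_act_pi x w : ad_act x (\pi_Ad w) = rack_word x w.
Proof. exact/rack_word_pcong/pcong_repr. Qed.

Lemma ad_act_gen x y : ad_act x (ad_gen y) = x ◁ y.
Proof. exact: (ad_act_pi x [:: (y, true)]). Qed.

Lemma ad_actM x (g h : Ad) : ad_act x (g * h)%g = ad_act (ad_act x g) h.
Proof.
rewrite -[g]reprK -[h]reprK pgroup_mulE !ad_act_pi.
by rewrite /rack_word foldl_cat.
Qed.

Lemma ad_act1 x : ad_act x 1%g = x.
Proof. exact: (ad_act_pi x [::]). Qed.

Lemma ad_gen_comm x y : (ad_gen x * ad_gen y = ad_gen y * ad_gen (x ◁ y))%g.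
Proof. by rewrite !pgroup_mulE; apply/pgroupP/pcong_rel. Qed.

Lemma ad_gen_act x (g : Ad) : (g^-1 * ad_gen x * g)%g = ad_gen (ad_act x g).
Proof.
suff H : (ad_gen x * g = g * ad_gen (ad_act x g))%g.
  by rewrite -mulgA H mulKg.
rewrite -[g]reprK ad_act_pi; move: (repr g) => w; elim: w x => [|l w IH] x.
  by rewrite [\pi _]/(1%g : Ad) mulg1 mul1g.
have -> : \pi_Ad (l :: w) = (\pi_Ad [:: l] * \pi_Ad w)%g by rewrite pgroup_mulE.
rewrite -mulgA -[rack_word x (l :: w)]/(rack_word (rack_exp x l) w) -IH !mulgA.
congr (_ * _)%g; case: l => y [] /=; first exact: ad_gen_comm.
have -> : \pi_Ad [:: (y, false)] = (ad_gen y)^-1%g by rewrite pgroup_invE.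
apply: (mulgI (ad_gen y)); apply: (mulIg (ad_gen y)).
rewrite mulVKg [RHS]ad_gen_comm /rack_exp /= rack_opVK.
by rewrite -mulgA mulgVK.
Qed.

End Adjoint.

Section FreeProduct.
Variables (S : choiceType) (G : S -> groupType).

Inductive fp_rel : seq ({s : S & G s} * bool) -> seq ({s : S & G s} * bool) -> Prop :=
| FpRel (s : S) (g h : G s) :
    fp_rel [:: (Tagged G g, true); (Tagged G h, true)]
           [:: (Tagged G (g * h)%g, true)].

Definition fprod_group : Type := pgroup fp_rel.
HB.instance Definition _ := Group.on fprod_group.
HB.instance Definition _ := EqQuotient.on fprod_group.

Definition fp_in (s : S) (g : G s) : fprod_group := pgen fp_rel (Tagged G g).

Lemma fp_inM s (g h : G s) : fp_in (g * h)%g = (fp_in g * fp_in h)%g.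
Proof. by rewrite pgroup_mulE; apply/esym/pgroupP/pcong_rel. Qed.

Lemma fp_in1 s : fp_in (1 : G s)%g = 1%g.
Proof. by apply: (mulgI (@fp_in s 1%g)); rewrite -fp_inM !mulg1. Qed.

Lemma fp_inV s (g : G s) : fp_in g^-1%g = (fp_in g)^-1%g.
Proof. by apply: (mulgI (fp_in g)); rewrite -fp_inM !mulgV fp_in1. Qed.

(* A factorization is a sequence of nontrivial elements of the factors, any *)
(* two consecutive ones lying in different factors.                         *)
Definition is_factorization (g : fprod_group) (w : seq {s : S & G s}) : Prop :=
  [/\ all (fun p : {s : S & G s} => tagged p != 1%g) w,
      sorted (fun p q : {s : S & G s} => tag p != tag q) w
    & g = (\prod_(p <- w) fp_in (tagged p))%g].

(* Existence and uniqueness of the factorization is the normal form theorem *)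
(* for free products, so the default value [::] of [xget] plays no role.    *)
Definition factorization (g : fprod_group) : seq {s : S & G s} :=
  xget [::] [set w | is_factorization g w].

End FreeProduct.

Arguments fp_in {S G s} g.

Section FreeRack.
Variables (S : choiceType) (X : S -> rackType).
Notation G := (fprod_group (fun s => Ad (X s))).
Notation pairs := ({t : S & X t} * G)%type.

Definition gp_in (s : S) (g : Ad (X s)) : G :=
  fp_in (G := fun s => Ad (X s)) g.

Definition fp_e (y : {t : S & X t}) : G := gp_in (ad_gen (tagged y)).

Inductive fr_step : pairs -> pairs -> Prop :=
| FrStep (t : S) (x : X t) (g : Ad (X t)) (w : G) :
    fr_step (Tagged X x, gp_in g * w)%g (Tagged X (ad_act x g), w).

Definition fr_eq (p q : pairs) : bool := `[< clos_refl_sym_trans pairs fr_step p q >].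

Lemma fr_eq_refl : reflexive fr_eq.
Proof. by move=> p; apply/asboolP; exact: rst_refl. Qed.

Lemma fr_eq_sym : symmetric fr_eq.
Proof. by move=> p q; apply/asboolP/asboolP; exact: rst_sym. Qed.

Lemma fr_eq_trans : transitive fr_eq.
Proof.
move=> q p r /asboolP pq /asboolP qr; apply/asboolP; exact: rst_trans pq qr.
Qed.

Canonical fr_equiv := EquivRel fr_eq fr_eq_refl fr_eq_sym fr_eq_trans.

Definition free_rack : Type := {eq_quot fr_equiv}.
HB.instance Definition _ := Choice.on free_rack.
HB.instance Definition _ := EqQuotient.on free_rack.

Lemma free_rackP (p q : pairs) :
  clos_refl_sym_trans pairs fr_step p q <-> \pi_free_rack p = \pi_free_rack q.
Proof.
split=> [pq|/eqmodP pq]; last exact/asboolP.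
by apply/eqmodP/asboolP.
Qed.

Definition fr_op_pair (p q : pairs) : pairs :=
  (p.1, p.2 * q.2^-1 * fp_e q.1 * q.2)%g.

Definition fr_op : free_rack -> free_rack -> free_rack :=
  lift_op2 free_rack fr_op_pair.

Lemma fr_mulr (p q : pairs) (c : G) : clos_refl_sym_trans pairs fr_step p q ->
  clos_refl_sym_trans pairs fr_step (p.1, p.2 * c)%g (q.1, q.2 * c)%g.
Proof.
elim=> {p q}.
- move=> _ _ [t x g w] /=; rewrite -mulgA; exact/rst_step/FrStep.
- by move=> p; exact: rst_refl.
- by move=> p q _; exact: rst_sym.
- by move=> p q r _ pq _; exact: rst_trans pq.
Qed.

Lemma fr_conj (p q : pairs) : clos_refl_sym_trans pairs fr_step p q ->
  (p.2^-1 * fp_e p.1 * p.2 = q.2^-1 * fp_e q.1 * q.2)%g.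
Proof.
elim=> {p q} //; last by move=> p q r _ -> _ ->.
move=> _ _ [t x g w] /=; rewrite /fp_e /= -ad_gen_act /gp_in !fp_inM fp_inV.
by rewrite invgM !mulgA.
Qed.

Lemma fr_op_pi (p q : pairs) :
  fr_op (\pi_free_rack p) (\pi_free_rack q) = \pi_free_rack (fr_op_pair p q).
Proof.
have reprP r : clos_refl_sym_trans pairs fr_step (repr (\pi_free_rack r)) r.
  by apply/free_rackP; rewrite reprK.
unlock fr_op; apply/free_rackP; rewrite /fr_op_pair -!mulgA.
have := fr_conj (reprP q); rewrite -!mulgA => ->.
exact: (fr_mulr _ (reprP p)).
Qed.

Lemma fr_op_distr (a b c : free_rack) :
  fr_op (fr_op a b) c = fr_op (fr_op a c) (fr_op b c).
Proof.
rewrite -[a]reprK -[b]reprK -[c]reprK !fr_op_pi; congr (\pi_free_rack _).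
rewrite /fr_op_pair /=; congr pair.
by rewrite !invgM !invgK !mulgA !(mulgK, mulgVK).
Qed.

Lemma fr_op_bij (b : free_rack) : bijective (fr_op^~ b).
Proof.
pose q := repr b.
pose f (a : free_rack) : free_rack :=
  \pi_free_rack ((repr a).1, (repr a).2 * q.2^-1 * (fp_e q.1)^-1 * q.2)%g.
have fE (p : pairs) : f (\pi_free_rack p) = \pi_free_rack (p.1, p.2 * q.2^-1 * (fp_e q.1)^-1 * q.2)%g.
  apply/free_rackP; rewrite -!mulgA; apply: fr_mulr.
  by apply/free_rackP; rewrite reprK.
exists f => a; rewrite -[a]reprK -[b]reprK -/q; move: (repr a) => p.
  rewrite fr_op_pi fE; congr (\pi_free_rack _); case: p => x g.
  by rewrite /fr_op_pair /= !mulgK mulgVK.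
rewrite fE fr_op_pi; congr (\pi_free_rack _); case: p => x g.
by rewrite /fr_op_pair /= mulgK !mulgVK.
Qed.

HB.instance Definition _ := isRack.Build free_rack fr_op_distr fr_op_bij.

Definition fr_class (p : pairs) : free_rack := \pi_free_rack p.

(* [(x, g)] with [x] in [X t] is reduced when the first letter of the *)
(* factorization of [g] (if any) does not lie in the factor [t].      *)
Definition reduced_pair (p : pairs) : bool :=
  if factorization p.2 is l :: _ then tag l != tag p.1 else true.

End FreeRack.

Local Open Scope ring_scope.

Section V0.
Variables (R : realType) (S : choiceType) (G : S -> groupType).

(* A family (lam_s : G s -> R)_s is encoded as a function on the disjoint *)
(* union of the G s; the bound below is uniform in both s and g.          *)
Definition V0_pred : {pred {s : S & G s} -> R^o} := fun lam =>
  `[< (forall s (g : G s), lam (Tagged G g^-1%g) = - lam (Tagged G g))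
   /\ exists M : R, forall s (g : G s), `|lam (Tagged G g)| <= M >].

Lemma V0_closed : submod_closed V0_pred.
Proof.
split.
  apply/asboolP; split=> [s g|]; first by rewrite oppr0.
  by exists 0 => s g; rewrite normr0.
move=> c f g /asboolP[fodd [M fM]] /asboolP[godd [N gN]]; apply/asboolP; split.
  by move=> s x; rewrite !fctE fodd godd scalerN opprD.
exists (`|c| * M + N) => s x; rewrite !fctE.
apply: le_trans (ler_normD _ _) _; apply: lerD; last exact: gN.
by rewrite normrM ler_wpM2l.
Qed.

HB.instance Definition _ :=
  GRing.isSubmodClosed.Build R ({s : S & G s} -> R^o) V0_pred V0_closed.

Record V0 := MkV0 { V0_val :> {s : S & G s} -> R^o; V0P : V0_val \in V0_pred }.
HB.instance Definition _ := [isSub for V0_val].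
HB.instance Definition _ := [Choice of V0 by <:].
HB.instance Definition _ := [SubChoice_isSubLmodule of V0 by <:].

Definition phi (lam : V0) (g : fprod_group G) : R :=
  \sum_(l <- factorization g) lam l.

End V0.

(* Every element of the free product is represented by a unique reduced pair. *)
Definition reduced_repr (S : choiceType) (X : S -> rackType) (a : free_rack X) :=
  xget (repr a) [set p | reduced_pair p /\ fr_class p = a].

Definition hatphi (R : realType) (S : choiceType) (X : S -> rackType)
    (lam : V0 R (fun s => Ad (X s))) (a : free_rack X) : R :=
  phi lam (reduced_repr a).2.

Section QuotientModule.
Variables (R : pzRingType) (V : lmodType R) (I : zmodClosed V).
Hypothesis IZ : GRing.scaler_closed I.
Local Notation Q := (Quotient.quot I).

Definition quot_scale (a : R) : Q -> Q :=
  lift_op1 Q (fun v => a *: v).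

Lemma pi_quot_scale a v :
  quot_scale a (\pi_Q v) = \pi_Q (a *: v).
Proof.
unlock quot_scale; apply/eqP; rewrite -Quotient.idealrBE -scalerBr IZ //.
by rewrite Quotient.idealrBE reprK.
Qed.

Lemma pi_quot_add u v : \pi_Q (u + v) = \pi_Q u + \pi_Q v :> Q.
Proof. exact: Quotient.pi_add. Qed.

Lemma quot_scaleA a b u : quot_scale a (quot_scale b u) = quot_scale (a * b) u.
Proof. by rewrite -[u]reprK !pi_quot_scale scalerA. Qed.

Lemma quot_scale1 : left_id 1 quot_scale.
Proof. by move=> u; rewrite -[u]reprK pi_quot_scale scale1r. Qed.

Lemma quot_scaleDr : right_distributive quot_scale +%R.
Proof.
move=> a u v; rewrite -[u]reprK -[v]reprK -pi_quot_add.
by rewrite !pi_quot_scale -pi_quot_add scalerDr.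
Qed.

Lemma quot_scaleDl u : {morph quot_scale^~ u : a b / a + b}.
Proof.
move=> a b; rewrite -[u]reprK !pi_quot_scale scalerDl.
exact: pi_quot_add.
Qed.

End QuotientModule.

Section Cohomology.
Variables (R : realType) (X : rackType).

Definition cochain (n : nat) : Type := n.-tuple X -> R^o.
HB.instance Definition _ n := GRing.Lmodule.on (cochain n).

Definition face0 n (i : 'I_n.+1) (x : n.+1.-tuple X) : n.-tuple X :=
  [tuple tnth x (lift i j) | j < n].

Definition face1 n (i : 'I_n.+1) (x : n.+1.-tuple X) : n.-tuple X :=
  [tuple if (j < i)%N then tnth x (lift i j) ◁ tnth x i else tnth x (lift i j)
   | j < n].

(* Indices start at 0 here, hence the exponent [i.+1]. For n = 0 the two *)
(* faces agree, so that [delta] vanishes on 0-cochains.                  *)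
Definition delta n (f : cochain n) : cochain n.+1 := fun x =>
  \sum_(i < n.+1) (-1) ^+ i.+1 * (f (face0 i x) - f (face1 i x)).

Definition bounded_cochain n (f : cochain n) : Prop :=
  exists M : R, forall x, `|f x| <= M.

Lemma delta_lin n (c : R) (f g : cochain n) :
  delta (c *: f + g) = c *: delta f + delta g.
Proof.
apply/funext => x; rewrite /delta !fctE scaler_sumr -big_split /=.
apply: eq_bigr => i _.
rewrite opprD addrACA -scalerBr mulrDr; congr (_ + _).
by rewrite -scalerAr.
Qed.

Lemma bounded_lin n (c : R) (f g : cochain n) :
  bounded_cochain f -> bounded_cochain g -> bounded_cochain (c *: f + g).
Proof.
move=> [M fM] [N gN]; exists (`|c| * M + N) => x; rewrite !fctE.
apply: le_trans (ler_normD _ _) _; apply: lerD; last exact: gN.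
by rewrite normrM ler_wpM2l.
Qed.

Lemma delta0 n : delta (0 : cochain n) = 0.
Proof.
apply/funext => x; rewrite /delta big1 // => i _.
by rewrite subrr mulr0.
Qed.

Lemma bounded0 n : bounded_cochain (0 : cochain n).
Proof. by exists 0 => x; rewrite normr0. Qed.

Definition Zb_pred n : {pred cochain n} := fun f =>
  `[< bounded_cochain f /\ delta f = 0 >].

Lemma Zb_closed n : submod_closed (@Zb_pred n).
Proof.
split; first by apply/asboolP; split; [exact: bounded0|exact: delta0].
move=> c f g /asboolP[fb f0] /asboolP[gb g0]; apply/asboolP; split.
  exact: bounded_lin.
by rewrite delta_lin f0 g0 scaler0 addr0.
Qed.

HB.instance Definition _ n :=
  GRing.isSubmodClosed.Build R (cochain n) (@Zb_pred n) (@Zb_closed n).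

Record Zb n := MkZb { Zb_val :> cochain n; ZbP : Zb_val \in @Zb_pred n }.
HB.instance Definition _ n := [isSub for @Zb_val n].
HB.instance Definition _ n := [Choice of Zb n by <:].
HB.instance Definition _ n := [SubChoice_isSubLmodule of Zb n by <:].

Definition Bb_pred n : {pred Zb n} :=
  match n with
  | 0 => fun c => `[< Zb_val c = 0 >]
  | m.+1 => fun c =>
      `[< exists2 g : cochain m, bounded_cochain g & Zb_val c = delta g >]
  end.

Lemma Bb_closed n : submod_closed (@Bb_pred n).
Proof.
case: n => [|m]; split.
- exact/asboolP.
- move=> c f g /asboolP f0 /asboolP g0; apply/asboolP.
  by rewrite [LHS]/= f0 g0 scaler0 addr0.
- by apply/asboolP; exists 0; [exact: bounded0|rewrite delta0].
- move=> c f g /asboolP[f' fb ff'] /asboolP[g' gb gg']; apply/asboolP.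
  exists (c *: f' + g'); first exact: bounded_lin.
  by rewrite delta_lin -ff' -gg'.
Qed.

HB.instance Definition _ n :=
  GRing.isSubmodClosed.Build R (Zb n) (@Bb_pred n) (@Bb_closed n).

Lemma Bb_scaler_closed n : GRing.scaler_closed (@Bb_pred n).
Proof. by move=> a c; exact: rpredZ. Qed.

Definition Hb n : Type := Quotient.quot (@Bb_pred n).
HB.instance Definition _ n := GRing.Zmodule.on (Hb n).
HB.instance Definition _ n := GRing.Zmodule_isLmodule.Build R (Hb n)
  (quot_scaleA (@Bb_scaler_closed n)) (quot_scale1 (@Bb_scaler_closed n))
  (quot_scaleDr (@Bb_scaler_closed n)) (quot_scaleDl (@Bb_scaler_closed n)).
HB.instance Definition _ n := EqQuotient.on (Hb n).

Definition Hb_class n (c : Zb n) : Hb n := \pi_(Hb n) c.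

End Cohomology.

(* Main.v *)
(* Letters act on normal words so that equal elements of a free product act
   equally; this gives uniqueness of factorizations. Cancelling at the junction
   of two factorizations shows that phi_lambda is a quasimorphism, and the value
   of hatphi_lambda at (x, g) is phi_lambda g up to one letter, so delta hatphi
   is bounded.
   If delta hatphi = delta b with b bounded, then hatphi - b is invariant under
   the adjoint group, so g |-> hatphi_lambda (x, g) is bounded. For 1 != g in
   Ad(X_s), t != s, x in X_t and h = e_x, evaluating at (g h g h^-1)^n gives
   2 n lambda_s(g), hence lambda_s(g) = 0. The generator e_x is nontrivial
   because the defining relations of Ad(X_t) preserve the parity of words. *)
Require Import Defs.
From HB Require Import structures.
From Stdlib Require Import Relation_Operators.
From mathcomp Require Import all_boot all_order all_algebra.
From mathcomp Require Import boolp classical_sets reals.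
From mathcomp Require Import ring lra.

Set Implicit Arguments.
Unset Strict Implicit.
Unset Printing Implicit Defensive.

Import Order.TTheory GRing.Theory Num.Theory.

Local Open Scope quotient_scope.
Local Open Scope rack_scope.
Local Open Scope ring_scope.

(** * Normal forms in free products of groups *)

Section NormalForm.
Variables (S : choiceType) (G : S -> groupType).
Local Notation L := {s : S & G s}.
Implicit Types (l : L) (w : seq L).

Definition word_prod w : fprod_group G := (\prod_(l <- w) fp_in (tagged l))%g.

Definition normal_word w : bool :=
  all (fun l => tagged l != 1%g) w && sorted (fun l m => tag l != tag m) w.

(* With [head_in] and [strip_head], [w] stands for the product of an element of
   [G s] (possibly trivial) and a word that does not start in [G s]. *)
Definition head_in (s : S) w : G s :=
  if w is l :: _ then tagged_as (Tagged G (1%g : G s)) l else 1%g.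

Definition strip_head (s : S) w : seq L :=
  if w is l :: w' then if tag l == s then w' else w else [::].

Definition cons_letter l w : seq L := if tagged l == 1%g then w else l :: w.

(** Van der Waerden's device: left multiplication by an element of one factor, carried out on normal
    words. *)
Definition letter_mul (s : S) (g : G s) w : seq L :=
  cons_letter (Tagged G (g * head_in s w)%g) (strip_head s w).

Lemma word_prod_nil : word_prod [::] = 1%g.
Proof. by rewrite /word_prod big_nil. Qed.

Lemma word_prod_cons l w :
  word_prod (l :: w) = (fp_in (tagged l) * word_prod w)%g.
Proof. by rewrite /word_prod big_cons. Qed.

Lemma word_prod_cat v w :
  word_prod (v ++ w) = (word_prod v * word_prod w)%g.
Proof. by rewrite /word_prod big_cat. Qed.

Lemma is_factorizationE g w :
  is_factorization g w <-> normal_word w /\ g = word_prod w.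
Proof.
split=> [[nt srt ->]|[/andP[nt srt] ->]]; last by split.
by rewrite /normal_word nt srt.
Qed.

Lemma word_prod_cons_letter l w :
  word_prod (cons_letter l w) = (fp_in (tagged l) * word_prod w)%g.
Proof.
rewrite /cons_letter; case: eqP => [->|_]; last exact: word_prod_cons.
by rewrite fp_in1 mul1g.
Qed.

Lemma word_prod_head_strip s w :
  word_prod w = (fp_in (head_in s w) * word_prod (strip_head s w))%g.
Proof.
case: w => [|[t g] w] /=; first by rewrite fp_in1 mul1g.
case: eqP => [<-|/eqP ne]; first by rewrite tagged_asE word_prod_cons.
rewrite /tagged_as /=; case: eqP => [e|_]; last by rewrite fp_in1 mul1g.
by rewrite -e eqxx in ne.
Qed.

Lemma word_prod_letter_mul s (g : G s) w :
  word_prod (letter_mul g w) = (fp_in g * word_prod w)%g.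
Proof.
by rewrite word_prod_cons_letter fp_inM -mulgA -word_prod_head_strip.
Qed.

Lemma head_strip_neq s l w : tag l != s ->
  head_in s (l :: w) = 1%g /\ strip_head s (l :: w) = l :: w.
Proof.
move=> ne; rewrite /= (negPf ne) /tagged_as /=; split=> //.
by case: eqP => // e; rewrite -e eqxx in ne.
Qed.

(** Neighbouring letters lie in different factors, so below a letter of [G s] no second one can
    surface. *)
Lemma head_strip_strip s w : normal_word w ->
  head_in s (strip_head s w) = 1%g
  /\ strip_head s (strip_head s w) = strip_head s w.
Proof.
case: w => [//|l w] /andP[_] /=.
case: eqP => [els|/eqP ne _]; last exact: head_strip_neq.
case: w => [|m w] //= /andP[lm _]; apply: head_strip_neq.
by rewrite -els eq_sym.
Qed.

Lemma normal_strip_head s w : normal_word w -> normal_word (strip_head s w).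
Proof.
case: w => [//|l w] /= nw; case: eqP => // _.
by case/andP: nw => /andP[_ nt] /path_sorted srt; apply/andP.
Qed.

Lemma normal_letter_mul s (g : G s) w :
  normal_word w -> normal_word (letter_mul g w).
Proof.
move=> nw; rewrite /letter_mul /cons_letter.
case: eqP => [_|/eqP ne]; first exact: normal_strip_head.
have [_] := head_strip_strip s nw; have /andP[] := normal_strip_head s nw.
rewrite /normal_word /= ne; case: (strip_head s w) => [//|m v] -> srt /=.
rewrite [path _ _ _]srt andbT.
(* [strip_head s] fixes [m :: v]; were [tag m] equal to [s], it would return the shorter [v]. *)
by case: eqP => [-> /(congr1 size)/n_Sn //|/eqP ne' _]; rewrite eq_sym.
Qed.

Lemma head_letter_mul s (g : G s) w : normal_word w ->
  head_in s (letter_mul g w) = (g * head_in s w)%g.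
Proof.
move=> nw; rewrite /letter_mul /cons_letter.
case: eqP => [/= ->|_]; first by case: (head_strip_strip s nw).
by rewrite /= tagged_asE.
Qed.

Lemma strip_letter_mul s (g : G s) w : normal_word w ->
  strip_head s (letter_mul g w) = strip_head s w.
Proof.
move=> nw; rewrite /letter_mul /cons_letter.
case: eqP => [/= _|_]; first by case: (head_strip_strip s nw).
by rewrite /= eqxx.
Qed.

(** In the coordinates [head_in s] and [strip_head s], [letter_mul] is left multiplication on the
    first and the identity on the second. *)
Lemma letter_mulM s (g h : G s) w : normal_word w ->
  letter_mul g (letter_mul h w) = letter_mul (g * h)%g w.
Proof.
move=> nw; rewrite {1}/letter_mul head_letter_mul // strip_letter_mul //.
by rewrite mulgA.
Qed.

Lemma head_strip_sorted l w : normal_word (l :: w) ->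
  head_in (tag l) w = 1%g /\ strip_head (tag l) w = w.
Proof.
case: w => [//|m w] /andP[_] /= /andP[lm _].
by apply: head_strip_neq; rewrite eq_sym.
Qed.

Lemma letter_mul_cons l w :
  normal_word (l :: w) -> letter_mul (tagged l) w = l :: w.
Proof.
case: l => s g nw; rewrite /letter_mul; have [-> ->] := head_strip_sorted nw.
rewrite mulg1 /cons_letter /=.
by case/andP: nw => /= /andP[/negPf-> _] _.
Qed.

Lemma letter_mul1 s w : normal_word w -> letter_mul (1%g : G s) w = w.
Proof.
rewrite /letter_mul mul1g; case: w => [|[t g] w] nw.
  by rewrite /cons_letter /= eqxx.
have [ets|/eqP ne] := eqVneq t s; last first.
  have [-> ->] := @head_strip_neq s (Tagged G g) w (introN eqP ne).
  by rewrite /cons_letter /= eqxx.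
subst s; rewrite /= tagged_asE eqxx /cons_letter /=.
by case/andP: nw => /= /andP[/negPf-> _] _.
Qed.

Definition word_act (u : seq (L * bool)) w : seq L :=
  foldr (fun (l : L * bool) =>
    letter_mul (if l.2 then tagged l.1 else (tagged l.1)^-1%g)) w u.

Lemma normal_word_act u w : normal_word w -> normal_word (word_act u w).
Proof. by elim: u => //= l u IH nw; apply/normal_letter_mul/IH. Qed.

(** Both the cancellation of inverse letters and the product relation reduce to [letter_mulM], which
    is why [w] must be normal. *)
Lemma word_act_pcong u v w :
  pcong (@fp_rel S G) u v -> normal_word w -> word_act u w = word_act v w.
Proof.
move=> uv; elim: uv w => {u v}.
- by [].
- by move=> u v _ IH w nw; rewrite IH.
- by move=> u v w _ uv _ vw w' nw; rewrite uv // vw.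
- move=> u u' v v' _ uu' _ vv' w nw.
  rewrite /word_act !foldr_cat -!/(word_act _ _) vv' // uu' //.
  exact: normal_word_act.
- by move=> l [] w nw /=; rewrite letter_mulM // ?mulgV ?mulVg letter_mul1.
- by move=> _ _ [s g h] w nw /=; rewrite letter_mulM.
Qed.

Lemma word_prod_act u w :
  word_prod (word_act u w) = (\pi_(fprod_group G) u * word_prod w)%g.
Proof.
elim: u => [|[l b] u IH] /=.
  by rewrite [\pi _]/(1%g : fprod_group G) mul1g.
rewrite word_prod_letter_mul IH.
have -> : \pi_(fprod_group G) ((l, b) :: u)
    = (\pi_(fprod_group G) [:: (l, b)] * \pi_(fprod_group G) u)%g.
  by rewrite pgroup_mulE.
rewrite -mulgA; congr (_ * _)%g; case: b; last rewrite fp_inV.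
  by case: l.
by rewrite pgroup_invE; case: l.
Qed.

Lemma word_act_letters w :
  normal_word w -> word_act [seq (l, true) | l <- w] [::] = w.
Proof.
elim: w => //= l w IH nlw; rewrite IH ?letter_mul_cons //.
by case/andP: nlw => /= /andP[_ nt] /path_sorted srt; apply/andP.
Qed.

(** The action depends only on the class of the acting word, so a group element rebuilds its normal
    word from [[::]]. Hence [word_prod] is injective on normal words. *)
Lemma word_act_prod w : normal_word w -> word_act (repr (word_prod w)) [::] = w.
Proof.
move=> nw; rewrite -[RHS](word_act_letters nw); apply: word_act_pcong => //.
have -> : word_prod w = \pi_(fprod_group G) [seq (l, true) | l <- w].
  have := word_prod_act [seq (l, true) | l <- w] [::].
  by rewrite word_act_letters // word_prod_nil mulg1.
exact: pcong_repr.
Qed.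

Lemma factorization_unique g w : is_factorization g w -> factorization g = w.
Proof.
move=> gw; have : is_factorization g (factorization g).
  (* The witness [w] rules out the default value of [xget]. *)
  by apply: (@xgetPex _ _ [set v | is_factorization g v]); exists w.
move: gw => /is_factorizationE[nw gw] /is_factorizationE[nf gf].
by rewrite -(word_act_prod nf) -gf gw word_act_prod.
Qed.

Lemma factorization_prod w : normal_word w -> factorization (word_prod w) = w.
Proof. by move=> nw; apply/factorization_unique/is_factorizationE. Qed.

(** Existence: any representative of [g], acting on [[::]], produces a normal word with product
    [g]. *)
Lemma factorizationP g :
  normal_word (factorization g) /\ word_prod (factorization g) = g.
Proof.
have nw : normal_word (word_act (repr g) [::]) by exact: normal_word_act.
have <- : word_prod (word_act (repr g) [::]) = g.
  by rewrite word_prod_act reprK word_prod_nil mulg1.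
by rewrite factorization_prod.
Qed.

Lemma factorization_mul s (g : G s) (k : fprod_group G) :
  factorization (fp_in g * k)%g = letter_mul g (factorization k).
Proof.
have [nk {1}<-] := factorizationP k.
by rewrite -word_prod_letter_mul factorization_prod // normal_letter_mul.
Qed.

Lemma factorization1 : factorization (1%g : fprod_group G) = [::].
Proof. by have := @factorization_prod [::] isT; rewrite word_prod_nil. Qed.

End NormalForm.

(** * The quasimorphism attached to a bounded odd family *)

Section Quasimorphism.
Variables (R : realType) (S : choiceType) (G : S -> groupType).
Local Notation L := {s : S & G s}.
Implicit Types (lam : V0 R G) (g h : fprod_group G) (w : seq L).

Lemma V0_odd lam s (g : G s) : lam (Tagged G g^-1%g) = - lam (Tagged G g).
Proof. by have /asboolP[] := V0P lam. Qed.

Lemma V0_bounded lam : exists2 M : R, 0 <= M & forall l, `|lam l| <= M.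
Proof.
have /asboolP[_ [M lamM]] := V0P lam; exists `|M| => // -[s g].
exact: le_trans (lamM s g) (ler_norm M).
Qed.

Lemma V0_one lam s : lam (Tagged G (1%g : G s)) = 0.
Proof.
have := V0_odd lam (1%g : G s); rewrite invg1 => /eqP.
by rewrite -addr_eq0 -mulr2n mulrn_eq0 => /eqP.
Qed.

Lemma phi_prod lam w :
  normal_word w -> phi lam (word_prod w) = \sum_(l <- w) lam l.
Proof. by move=> nw; rewrite /phi factorization_prod. Qed.

Lemma phi1 lam : phi lam 1%g = 0.
Proof. by rewrite /phi factorization1 big_nil. Qed.

(* Cancel inverse letters at the junction of the two factorizations; what is
   left differs from the concatenation of two words in at most three letters. *)
Lemma phi_quasimorphism lam (M : R) : 0 <= M -> (forall l, `|lam l| <= M) ->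
  forall g h, `|phi lam (g * h)%g - phi lam g - phi lam h| <= 3 * M.
Proof.
move=> M0 lamM g h.
have M30 : 0 <= 3 * M by rewrite mulr_ge0.
have [+ <-] := factorizationP g; have [+ <-] := factorizationP h.
move: (factorization g) (factorization h) => v w {g h}.
elim/last_ind: v w => [|v a IH] [|b w] nw nv.
- by rewrite word_prod_nil mul1g phi1 subrr subr0 normr0.
- by rewrite word_prod_nil mul1g phi1 subr0 subrr normr0.
- by rewrite word_prod_nil mulg1 phi1 subrr subr0 normr0.
have [nta sorta] := andP nv; have [ntb sortb] := andP nw.
move: nta; rewrite all_rcons => /andP[a1 ntv].
move: (ntb) => /= /andP[b1 ntw].
have normv : normal_word v.
  by rewrite /normal_word ntv; move: sorta; rewrite -cats1 => /cat_sorted2[->].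
have normw : normal_word w.
  by rewrite /normal_word ntw; move: (sortb) => /path_sorted ->.
rewrite -cats1 in nv *.
have [etag|ntag] := eqVneq (tag a) (tag b); last first.
  have nvw : normal_word ((v ++ [:: a]) ++ b :: w).
    rewrite /normal_word all_cat ntb cats1 all_rcons a1 ntv sorted_cat_cons.
    rewrite (sortb : path _ _ _) andbT; case: (v) sorta => [_|c u] /=.
      by rewrite ntag.
    by rewrite !rcons_path => ->; rewrite last_rcons ntag.
  rewrite -word_prod_cat !phi_prod // big_cat /= addrAC addrK subrr.
  by rewrite normr0.
case: a b etag => [s x] [t y] /= est in a1 b1 sorta sortb nv nw ntb *.
subst t.
have -> : (word_prod (v ++ [:: Tagged G x]) * word_prod (Tagged G y :: w)
           = word_prod v * (fp_in (x * y) * word_prod w))%g.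
  by rewrite word_prod_cat !word_prod_cons word_prod_nil mulg1 fp_inM !mulgA.
rewrite !(phi_prod _ nv, phi_prod _ nw) big_cat big_seq1 big_cons /=.
have [xy1|xy1] := eqVneq (x * y)%g 1%g.
  (* Here [y] is the inverse of [x]: by oddness their values cancel, and the defect is that of [v]
     and [w]. *)
  have := IH w normw normv; rewrite xy1 fp_in1 mul1g !phi_prod //.
  have -> : lam (Tagged G y) = - lam (Tagged G x).
    by rewrite -V0_odd; congr (lam (Tagged G _)); apply/esym/mulg1_eq.
  congr (`|_| <= _); ring.
have nvw : normal_word (v ++ Tagged G (x * y)%g :: w).
  rewrite /normal_word all_cat ntv /= xy1 ntw sorted_cat_cons /=.
  apply/andP; split; last by case: (w) sortb.
  by case: (v) sorta => //= c u; rewrite !rcons_path.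
rewrite -(word_prod_cons (Tagged G (x * y)%g)) -word_prod_cat.
rewrite phi_prod // big_cat big_cons /=.
have := lamM (Tagged G x); have := lamM (Tagged G y).
have := lamM (Tagged G (x * y)%g); rewrite !ler_norml.
move: (lam _) (lam _) (lam _) (bigop _ _ _) (bigop _ _ _) => p q r A B.
by move=> /andP[? ?] /andP[? ?] /andP[? ?]; apply/andP; split; lra.
Qed.

End Quasimorphism.

(** * The induced function on the free product of racks *)

Section FreeRackPhi.
Variables (R : realType) (S : choiceType) (X : S -> rackType).
Local Notation G := (fun s : S => Ad (X s)).
Local Notation pairs := ({t : S & X t} * fprod_group G)%type.
Implicit Types (lam : V0 R G) (p q : pairs) (a b : free_rack X).

(** A generating step with [x] in [X t] changes only the part of the factorization in [Ad (X t)] at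
    the front, which [strip_head t] discards. *)
Lemma fr_class_strip p q : fr_class p = fr_class q ->
  strip_head (tag p.1) (factorization p.2)
  = strip_head (tag q.1) (factorization q.2).
Proof.
move=> /free_rackP; elim=> {p q} //.
- move=> _ _ [t x g w] /=; rewrite factorization_mul strip_letter_mul //.
  by case: (factorizationP w).
- by move=> p q r _ -> _ ->.
Qed.

Lemma reduced_pair_strip p : reduced_pair p ->
  strip_head (tag p.1) (factorization p.2) = factorization p.2.
Proof.
by rewrite /reduced_pair; case: (factorization _) => //= l w /negPf->.
Qed.

(** The head in [Ad (X t)], possibly trivial, is moved onto [x] by the action. *)
Lemma reduced_exists a : exists p, reduced_pair p /\ fr_class p = a.
Proof.
case E : (repr a) => [[t x] g].
have aE : fr_class (Tagged X x, g) = a by rewrite /fr_class -E reprK.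
have [nf gE] := factorizationP g; set w := factorization g in nf gE.
have [_ st] := head_strip_strip t nf; have ns := normal_strip_head t nf.
exists (Tagged X (ad_act x (head_in t w)), word_prod (strip_head t w)).
split.
  rewrite /reduced_pair factorization_prod //=.
  case: (strip_head t w) st => //= l v; case: eqP => // _.
  by move/(congr1 size)/n_Sn.
rewrite -aE; apply/esym/free_rackP/rst_step.
by rewrite -[g in X in fr_step X]gE (word_prod_head_strip t w); constructor.
Qed.

(** Evaluates [hatphi] at an arbitrary representative: stripping is invariant on classes and changes
    nothing on reduced pairs. *)
Lemma hatphi_class lam p :
  hatphi lam (fr_class p)
  = \sum_(l <- strip_head (tag p.1) (factorization p.2)) lam l.
Proof.
have [red cl] : reduced_pair (reduced_repr (fr_class p))
    /\ fr_class (reduced_repr (fr_class p)) = fr_class p.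
  exact: (@xgetPex _ _ [set q | reduced_pair q /\ fr_class q = fr_class p]
            (reduced_exists _)).
by rewrite /hatphi /phi -(reduced_pair_strip red) (fr_class_strip cl).
Qed.

Lemma hatphi_phi lam (M : R) p : 0 <= M -> (forall l, `|lam l| <= M) ->
  `|hatphi lam (fr_class p) - phi lam p.2| <= M.
Proof.
move=> M0 lamM; rewrite hatphi_class /phi.
case: (factorization _) => [|l w] /=; first by rewrite big_nil subrr normr0.
case: eqP => _; last by rewrite subrr normr0.
by rewrite big_cons opprD addrCA subrr addr0 normrN.
Qed.

Lemma fr_class_op p q :
  fr_class p ◁ fr_class q = fr_class (fr_op_pair p q).
Proof. exact: fr_op_pi. Qed.

Lemma hatphi_coboundary_bounded lam :
  exists M : R, forall a b, `|hatphi lam a - hatphi lam (a ◁ b)| <= M.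
Proof.
(* Four quasimorphism defects cost [12 * M], two passages from [hatphi] to [phi] cost [2 * M], and
   the letter [e] costs [M]. *)
have [M M0 lamM] := V0_bounded lam; exists (15 * M) => a b.
rewrite -[a]reprK -[b]reprK -!/(fr_class _) fr_class_op.
move: (repr a) (repr b) => [x g] [y h].
rewrite /fr_op_pair /=; set e := fp_e y.
have eM : `|phi lam e| <= M.
  rewrite /phi -[e]mulg1 factorization_mul factorization1.
  rewrite /letter_mul /cons_letter /=.
  by case: eqP => _; rewrite ?big_nil ?big_seq1 ?normr0.
have := hatphi_phi (x, g) M0 lamM.
have := hatphi_phi (x, (g * h^-1 * e * h)%g) M0 lamM.
have qm := phi_quasimorphism M0 lamM.
have := qm (g * h^-1 * e)%g h; have := qm (g * h^-1)%g e.
have := qm g h^-1%g; have := qm h^-1%g h; rewrite mulVg phi1 /=.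
move: eM; rewrite !ler_norml.
move: (hatphi _ _) (hatphi _ _) => H1 H2.
move: (phi _ (_ * h)%g) (phi _ (_ * e)%g) (phi _ (_ * _)%g) => p1 p2 p3.
move: (phi _ _) (phi _ _) (phi _ _) (phi _ _) => p4 p5 p6 p7.
move=> /andP[? ?] /andP[? ?] /andP[? ?] /andP[? ?] /andP[? ?] /andP[? ?].
by move=> /andP[? ?]; apply/andP; split; lra.
Qed.

Lemma hatphi_linear (c : R) lam mu a :
  hatphi (c *: lam + mu) a = c * hatphi lam a + hatphi mu a.
Proof.
by rewrite /hatphi /phi mulr_sumr -big_split.
Qed.

(** Operating by the class of [(y, 1)] multiplies the group component on the right by [e_y]; such
    generators and their inverses give all of [Ad (X s)]. *)
Lemma ad_invariant (f : free_rack X -> R) (s : S) (g : Ad (X s)) :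
  (forall a b, f (a ◁ b) = f a) ->
  forall x (k : fprod_group G),
  f (fr_class (x, k * gp_in g)%g) = f (fr_class (x, k)).
Proof.
move=> fop.
have fgen (y : X s) x k :
    f (fr_class (x, k * gp_in (ad_gen y))%g) = f (fr_class (x, k)).
  rewrite -[RHS](fop _ (fr_class (Tagged X y, 1%g))) fr_class_op.
  by rewrite /fr_op_pair /= invg1 !mulg1.
rewrite -[g]reprK; elim: (repr g) => [|[y b] u IH] x k.
  by rewrite [\pi _]/(1%g : Ad (X s)) /gp_in fp_in1 mulg1.
have -> : \pi_(Ad (X s)) ((y, b) :: u)
    = (\pi_(Ad (X s)) [:: (y, b)] * \pi_(Ad (X s)) u)%g.
  by rewrite pgroup_mulE.
rewrite /gp_in fp_inM mulgA IH; case: b; first exact: fgen.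
have -> : \pi_(Ad (X s)) [:: (y, false)] = (ad_gen y)^-1%g.
  by rewrite pgroup_invE.
by rewrite -(fgen y) fp_inV mulgVK.
Qed.

Lemma fr_invariant (f : free_rack X -> R) : (forall a b, f (a ◁ b) = f a) ->
  forall x k, f (fr_class (x, k)) = f (fr_class (x, 1%g)).
Proof.
move=> fop x k; have [_ <-] := factorizationP k; rewrite -[word_prod _]mul1g.
elim: (factorization k) 1%g => [|[s g] w IH] h.
  by rewrite word_prod_nil mulg1.
by rewrite word_prod_cons mulgA IH; exact: ad_invariant.
Qed.

End FreeRackPhi.

(** * Nontriviality of the generators of an adjoint group *)

Lemma pcong_odd_size (T : choiceType)
    (rel : seq (T * bool) -> seq (T * bool) -> Prop) u v :
  (forall u' v', rel u' v' -> odd (size u') = odd (size v')) ->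
  pcong rel u v -> odd (size u) = odd (size v).
Proof.
move=> relodd; elim=> {u v} //.
- by move=> u v w _ -> _ ->.
- by move=> u u' v v' _ uu' _ vv'; rewrite !size_cat !oddD uu' vv'.
Qed.

Lemma ad_gen_neq1 (Y : rackType) (y : Y) : ad_gen y != 1%g.
Proof.
apply/eqP => /pgroupP /pcong_odd_size oddE.
by suff: odd 1 = odd 0 by []; apply: oddE => _ _ [].
Qed.

(** * Coboundaries and bounded classes in degree two *)

Section DegreeTwo.
Variables (R : realType) (Y : rackType).

Lemma delta1E (f : Y -> R) (x : 2.-tuple Y) :
  delta (fun z : 1.-tuple Y => f (thead z) : R^o) x
  = f (tnth x ord0) - f (tnth x ord0 ◁ tnth x ord_max).
Proof.
rewrite /delta !big_ord_recl big_ord0 /= addr0 expr1 sqrrN expr1n mul1r.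
(* No index precedes the first, so its two faces agree and its term vanishes. *)
have -> : face1 (@ord0 1) x = face0 ord0 x.
  by apply: eq_from_tnth => j; rewrite !tnth_mktuple.
rewrite subrr mulr0 add0r /thead !tnth_mktuple /=.
congr (f _ - f (_ ◁ _)); congr (tnth x _); exact: val_inj.
Qed.

Lemma delta_delta1 (f : Y -> R) :
  delta (delta (fun z : 1.-tuple Y => f (thead z) : R^o)) = 0.
Proof.
apply/funext => x; rewrite {1}/delta !big_ord_recl big_ord0.
case/tupleP: x => a x; case/tupleP: x => b x; case/tupleP: x => c x.
rewrite !delta1E !tnth_mktuple /= !(tnth_nth a) /= /bump /=.
(* Self-distributivity identifies [(a ◁ b) ◁ c] with [(a ◁ c) ◁ (b ◁ c)]; the other cancellations
   are formal. *)
by rewrite rack_distr -[RHS]/(0 : R); ring.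
Qed.

Lemma Hb_class_linear : linear (@Hb_class R Y 2).
Proof.
move=> c u v.
have -> : c *: Hb_class u = Hb_class (c *: u).
  exact: (pi_quot_scale (@Bb_scaler_closed R Y 2)).
exact: pi_quot_add.
Qed.

Lemma Hb_class_eq (c d : Zb R Y 2) :
  Hb_class c = Hb_class d -> c - d \in @Bb_pred R Y 2.
Proof. by move=> cd; rewrite Quotient.idealrBE; apply/eqP. Qed.

(** Take [h] to be [f] minus [b]: its coboundary vanishes, which is exactly invariance. *)
Lemma bounded_primitive_invariant (f : Y -> R) (b : cochain R Y 1) :
  bounded_cochain b -> delta (fun z : 1.-tuple Y => f (thead z)) = delta b ->
  exists2 h : Y -> R, forall x y, h (x ◁ y) = h x
    & exists M : R, forall x, `|f x - h x| <= M.
Proof.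
move=> [M bM] fb; exists (fun x => f x - b [tuple x]); last first.
  by exists M => x; rewrite subKr.
move=> x y.
have bE : b = fun z => b [tuple thead z].
  apply/funext => z; congr b; apply: eq_from_tnth => i.
  by rewrite [i]ord1 [RHS](tnth_nth (thead z)).
rewrite bE in fb.
have := congr1 (@^~ [tuple x; y]) fb.
rewrite /= (delta1E f) (delta1E (fun z => b [tuple z])) !(tnth_nth x) /=.
move: (b _) (b _) => p q; lra.
Qed.

End DegreeTwo.

(** * The map on cocycles and its kernel modulo bounded coboundaries *)

Section Injectivity.
Variables (R : realType) (S : choiceType) (X : S -> rackType).
Local Notation G := (fun s : S => Ad (X s)).
Implicit Types (lam : V0 R G).

Lemma hatphi_cocycle lam :
  delta (fun x : 1.-tuple (free_rack X) => hatphi lam (thead x))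
    \in @Zb_pred R (free_rack X) 2.
Proof.
apply/asboolP; split; last exact: delta_delta1.
have [M fM] := hatphi_coboundary_bounded lam.
by exists M => x; rewrite delta1E.
Qed.

Definition hatphi_Zb lam : Zb R (free_rack X) 2 := MkZb (hatphi_cocycle lam).

Lemma hatphi_Zb_linear : linear hatphi_Zb.
Proof.
move=> c lam mu; apply: val_inj; rewrite /= -delta_lin; congr delta.
by apply/funext => x; rewrite hatphi_linear.
Qed.

(** The factorization of the [n]-th power of [g h g h^-1]: by oddness the letters from [h]
    contribute nothing to the sum. *)
Definition alternating_word (s t : S) (g : G s) (h : G t) n :=
  iter n (cat [:: Tagged G g; Tagged G h; Tagged G g; Tagged G h^-1%g]) [::].

Lemma normal_alternating_word (s t : S) (g : G s) (h : G t) n :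
  s != t -> g != 1%g -> h != 1%g -> normal_word (alternating_word g h n).
Proof.
move=> st g1 h1; have ts : t != s by rewrite eq_sym.
have hV1 : h^-1%g != 1%g by rewrite -(inj_eq invg_inj) invgK invg1.
elim: n => // n; rewrite /alternating_word /= => /andP[nt srt].
rewrite /normal_word /= g1 h1 hV1 nt st ts /=.
by case: n srt {nt} => //= n ->; rewrite ts.
Qed.

Lemma sum_alternating_word lam (s t : S) (g : G s) (h : G t) n :
  \sum_(l <- alternating_word g h n) lam l = lam (Tagged G g) *+ n.*2.
Proof.
elim: n => [|n IH]; first by rewrite big_nil.
rewrite /alternating_word iterS big_cat -/(alternating_word g h n) IH.
rewrite !big_cons big_nil V0_odd doubleS !mulrS /=; ring.
Qed.

Lemma hatphi_Zb_ker lam : (exists s t : S, s != t) ->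
  (forall s, inhabited (X s)) -> hatphi_Zb lam \in @Bb_pred R (free_rack X) 2 ->
  lam = 0.
Proof.
move=> [s0 [t0 st0]] Xne /asboolP[b bb] /= /(bounded_primitive_invariant bb).
case=> f finv [M fM]; apply/val_inj/funext => -[s g] /=.
rewrite -[RHS]/(0 : R).
have [->|g1] := eqVneq g 1%g; first exact: V0_one.
have [t st] : exists t, s != t.
  have [e|] := eqVneq s s0; last by exists s0.
  by exists t0; rewrite e.
have [x] := Xne t; set h := ad_gen x; have h1 : h != 1%g := ad_gen_neq1 x.
(* The invariant function agrees at [(x, k)] and [(x, 1)], where [hatphi] is the sum over [k] and 0;
   each comparison costs [M]. *)
have bound n : `|lam (Tagged G g)| *+ n.*2 <= M + M.
  pose k := word_prod (alternating_word g h n).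
  have := fM (fr_class (Tagged X x, k)); have := fM (fr_class (Tagged X x, 1%g)).
  rewrite (fr_invariant finv _ k) !hatphi_class /= factorization1 big_nil.
  have nk := normal_alternating_word n st g1 h1.
  rewrite factorization_prod //.
  (* A nonempty alternating word starts in [G s] with [s != t], so nothing is stripped. *)
  have -> : strip_head t (alternating_word g h n) = alternating_word g h n.
    by case: (n) => //= m; rewrite (negPf st).
  rewrite sum_alternating_word -normrMn sub0r normrN !ler_norml.
  by move=> /andP[? ?] /andP[? ?]; apply/andP; split; lra.
(* Archimedean argument: for [n] above [(M + M)] divided by the norm, the bound would force
   [n.*2 < n]. *)
apply/eqP; rewrite -normr_le0 leNgt; apply/negP => lam0.
have MM : 0 <= (M + M) / `|lam (Tagged G g)|.
  by rewrite divr_ge0 // (le_trans _ (bound 0%N)).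
have := archi_boundP MM; set n := Num.bound _.
rewrite ltr_pdivrMr // mulrC mulr_natr => /(le_lt_trans (bound n)).
by rewrite ltr_pMn2l // -addnn ltnNge leq_addr.
Qed.

End Injectivity.

(** * Assembly of the linear map, with injectivity read off from its kernel *)

Theorem proposition3p5 (R : realType) (S : finType) (X : S -> rackType)
    (S_ge2 : (2 <= #|{: S}|)%N)
    (X_nonempty : forall s : S, inhabited (X s))
    (X_fg : forall s : S, rack_fg (X s)) :
  exists Phi : {linear V0 R (fun s : S => Ad (X s)) -> Hb R (free_rack X) 2},
    (forall lam : V0 R (fun s : S => Ad (X s)),
       exists2 c : Zb R (free_rack X) 2,
         Zb_val c = delta (fun x : 1.-tuple (free_rack X) => hatphi lam (thead x))
         & Phi lam = Hb_class c)
    /\ injective Phi.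
Proof.
have Phi_linear : linear (fun lam : V0 R (fun s : S => Ad (X s)) =>
    Hb_class (hatphi_Zb lam)).
  by move=> c lam mu; rewrite hatphi_Zb_linear Hb_class_linear.
pose Phi := HB.pack_for
  {linear V0 R (fun s : S => Ad (X s)) -> Hb R (free_rack X) 2}
  (fun lam : V0 R (fun s : S => Ad (X s)) => Hb_class (hatphi_Zb lam))
  (GRing.isLinear.Build _ _ _ _ _ Phi_linear).
exists Phi; split=> [lam|lam mu /= /Hb_class_eq lam_mu].
  by exists (hatphi_Zb lam).
have [s [t [_ _ st]]] := card_gt1P S_ge2.
apply/eqP; rewrite -subr_eq0; apply/eqP.
apply: hatphi_Zb_ker X_nonempty _; first by exists s, t.
have -> : hatphi_Zb (lam - mu) = hatphi_Zb lam - hatphi_Zb mu.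
  by rewrite -[lam - mu]addrC -scaleN1r hatphi_Zb_linear scaleN1r addrC.
exact: lam_mu.
Qed.
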